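(* Let $q$ be an indefinite real quadratic form on $\mathbb{R}^n$, and let $r$ be a real quadratic form on $\mathbb{R}^n$ such that $Z_q \subset Z_r$; that is, for all $\mathbf{x} \in \mathbb{R}^n$, $q(\mathbf{x}) = 0 \implies r(\mathbf{x}) = 0$. Then $r$ is proportional to $q$; that is, there exists a real number $\alpha$ such that $r(\mathbf{x}) = \alpha q(\mathbf{x})$ for all $\mathbf{x} \in \mathbb{R}^n$. If $\alpha$ is not zero, then $r$ is also indefinite and has the same zero set as $q$, i.e. $Z_r = Z_q$.
   Context: A function $q : \mathbb{R}^n \to \mathbb{R}$ is a real quadratic form if there is a symmetric bilinear function $\tilde{q} : \mathbb{R}^n \times \mathbb{R}^n \to \mathbb{R}$ such that $q(\mathbf{x}) = \tilde{q}(\mathbf{x}, \mathbf{x})$ for all $\mathbf{x}$. A real quadratic form is indefinite if it takes both positive and negative values. For a real quadratic form $q$ on $\mathbb{R}^n$, its zero set is $Z_q = \{\mathbf{x} \in \mathbb{R}^n : q(\mathbf{x}) = 0\}$. The symbol $\subset$ denotes (not necessarily proper) inclusion. *)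

(* Defs.v *)
From mathcomp Require Import all_boot all_order all_algebra.
From mathcomp Require Import classical_sets reals.
Set Implicit Arguments.
Unset Strict Implicit.
Unset Printing Implicit Defensive.
Import Order.TTheory GRing.Theory Num.Theory.
Local Open Scope ring_scope.
Local Open Scope classical_set_scope.

(* [{symmetric V}] is the type of bilinear maps [b : V -> V -> R] such that
   [b x y = (-1) ^+ false * idfun (b y x)], that is, [b x y = b y x]. *)
Definition quadratic_form (R : realType) (n : nat) (q : 'rV[R]_n -> R) : Prop :=
  exists b : {symmetric 'rV[R]_n}, forall x, q x = b x x.

Definition indefinite (R : realType) (n : nat) (q : 'rV[R]_n -> R) : Prop :=
  (exists x, 0 < q x) /\ (exists x, q x < 0).

Definition zero_set (R : realType) (n : nat) (q : 'rV[R]_n -> R) :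
    set 'rV[R]_n :=
  [set x | q x = 0].

(* Main.v *)
Require Import Defs.
From mathcomp Require Import all_boot all_order all_algebra.
From mathcomp Require Import classical_sets reals.
From mathcomp Require Import ring lra.
Set Implicit Arguments.
Unset Strict Implicit.
Unset Printing Implicit Defensive.
Import Order.TTheory GRing.Theory Num.Theory.
Local Open Scope ring_scope.
Local Open Scope classical_set_scope.

(* If q x > 0 > q y, the plane spanned by x and y contains two independent
   zeros of q, on which r vanishes too; comparing the products of the roots of
   the quadratic polynomials t |-> q (x + t y) and t |-> r (x + t y) gives
   q y * r x = q x * r y.  Fixing one vector on which q is positive and one on
   which it is negative, this makes r / q constant off the zero set of q. *)

Lemma symmetric_formDZ (R : comNzRingType) (V : lmodType R)
    (b : {symmetric V}) (s t : R) (x y : V) :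
  b (s *: x + t *: y) (s *: x + t *: y) =
  s ^+ 2 * b x x + 2%:R * (s * t * b x y) + t ^+ 2 * b y y.
Proof.
have sym : b y x = b x y by have /= := hermC b y x; rewrite expr0 mul1r.
by rewrite !(linearDl, linearDr, linearZl_LR, linearZr_LR) /= sym; ring.
Qed.

Lemma quadratic_form_cross (R : realType) (n : nat) (q r : 'rV[R]_n -> R)
    (x y : 'rV[R]_n) :
  quadratic_form q -> quadratic_form r -> zero_set q `<=` zero_set r ->
  0 < q x -> q y < 0 -> q y * r x = q x * r y.
Proof.
move=> [b qE] [c rE] hqr qx_gt0 qy_lt0.
set B := b x y; set D := B ^+ 2 - q y * q x.
(* [D] is a quarter of the discriminant of [t |-> q (x + t y)]; the opposite signs of [q x] and
   [q y] make it positive. *)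
have D_gt0 : 0 < D by rewrite /D; nra.
have [S_gt0 S2] : 0 < Num.sqrt D /\ Num.sqrt D ^+ 2 = D.
  by rewrite sqrtr_gt0 sqr_sqrtr // ltW.
set S := Num.sqrt D in S_gt0 S2.
(* Substituting [t = u / q y] and scaling the vector by [q y] avoids division: the zeros of [q] on
   this line are at [u = S - B] and [u = - S - B]. *)
have r_root u : (u + B) ^+ 2 = D ->
    q y ^+ 2 * r x + 2%:R * (q y * u * c x y) + u ^+ 2 * r y = 0.
  move=> uE; rewrite !rE -symmetric_formDZ -rE; apply: hqr.
  rewrite /zero_set /= qE symmetric_formDZ -!qE -/B.
  have -> : q y ^+ 2 * q x + 2%:R * (q y * u * B) + u ^+ 2 * q y =
            q y * ((u + B) ^+ 2 - D) by rewrite /D; ring.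
  by rewrite uE subrr mulr0.
have /r_root E1 : (S - B + B) ^+ 2 = D by rewrite subrK.
have /r_root E2 : (- S - B + B) ^+ 2 = D by rewrite subrK sqrrN.
have qyS_neq0 : 2%:R * S * q y != 0.
  by rewrite !mulf_neq0 ?pnatr_eq0 // ?(gt_eqF S_gt0) ?(lt_eqF qy_lt0).
apply/(mulfI qyS_neq0)/eqP; rewrite -subr_eq0; apply/eqP.
have prodE : q y * q x = B ^+ 2 - S ^+ 2 by rewrite S2 /D; ring.
transitivity (2%:R * S * (q y ^+ 2 * r x - q y * q x * r y)); first by ring.
rewrite prodE.
(* Weighting each root's equation by the other root cancels the unknown [c x y]. The difference of
   the roots, [2 S], factors out, and their product is [q y * q x] by [prodE]. *)
transitivity ((S - B) * 0 - (- S - B) * 0 : R); last by ring.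
by rewrite -{1}E2 -E1; ring.
Qed.

Theorem theorem1 (R : realType) (n : nat) (q r : 'rV[R]_n -> R)
    (hq : quadratic_form q) (q_indef : indefinite q) (hr : quadratic_form r)
    (hqr : zero_set q `<=` zero_set r) :
  exists alpha : R,
    (forall x, r x = alpha * q x) /\
    (alpha <> 0 -> indefinite r /\ zero_set r = zero_set q).
Proof.
have [[a qa_gt0] [b qb_lt0]] := q_indef.
have cross x y := @quadratic_form_cross _ _ _ _ x y hq hr hqr.
have qa0 : q a != 0 by rewrite gt_eqF.
have qb0 : q b != 0 by rewrite lt_eqF.
have rE x : r x = r a / q a * q x.
  have [qx_lt0|qx_gt0|qx0] := ltgtP (q x) 0.
  - by apply: (mulfI qa0); rewrite -cross //; field.
  (* As [x] and [a] are both positive for [q], they are compared through [b]. *)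
  - apply: (mulfI qb0); rewrite cross //.
    transitivity (q b * r a * q x / q a); last by field.
    by rewrite (cross a b) //; field.
  - by rewrite qx0 mulr0; apply: hqr.
exists (r a / q a); split=> // /eqP; move: rE; set al := r a / q a => rE al0.
split.
  have [al_lt0|al_gt0] : al < 0 \/ 0 < al.
    by apply/orP; rewrite -neq_lt.
  - by split; [exists b | exists a]; rewrite rE; [rewrite nmulr_rgt0 | rewrite nmulr_rlt0].
  - by split; [exists a | exists b]; rewrite rE; [rewrite pmulr_rgt0 | rewrite pmulr_rlt0].
(* One inclusion is [hqr]; the other cancels the nonzero [al]. *)
apply/seteqP; split=> // x; rewrite /zero_set /= rE => /eqP.
by rewrite mulf_eq0 (negPf al0) => /eqP.
Qed.
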